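(* Let $a\ge3$ be an integer and $\widetilde{\mathcal Z}=\widetilde R_{a,1}\cup\widetilde R_{1,a}$. Then for all $\alpha\in(0,1)$, $$a-2\alpha-9a\alpha^{3/2}\le\widetilde I(\alpha,\alpha,\widetilde{\mathcal Z})\le a-2\alpha.$$
   Context: $\widetilde R_{a,b}=[0,a]\times[0,b]$. A Euclidean zero-set is a closed $\widetilde{\mathcal Z}\subseteq[0,\infty)^2$ such that $(a,b)\in\widetilde{\mathcal Z}$ implies $\widetilde R_{a,b}\subseteq\widetilde{\mathcal Z}$, and $\widetilde{\mathcal Z}$ is the closure of $\widetilde{\mathcal Z}\cap(0,\infty)^2$. For Borel $A\subseteq[0,\infty)^2$, $\widetilde{\mathrm{row}}(x,A)$ (resp. $\widetilde{\mathrm{col}}(x,A)$) is the 1-dimensional Lebesgue measure of $A$ intersected with the horizontal (resp. vertical) line through $x$. For left-continuous nonincreasing $f,g:[0,\infty)\to[0,\infty)$ of compact support, $\widetilde{\mathcal T}(A)=A\cup\{(u,v):(\widetilde{\mathrm{row}}((u,v),A)+f(v),\widetilde{\mathrm{col}}((u,v),A)+g(u))\notin\widetilde{\mathcal Z}\}$; $A$ E-spans for $(\widetilde{\mathcal Z},f,g)$ if $\bigcup_n\widetilde{\mathcal T}^n(A)=[0,\infty)^2$. For bounded $\widetilde{\mathcal Z}$ and $(\alpha,\beta)\in[0,1]^2$: $\widetilde I(\alpha,\beta,\widetilde{\mathcal Z})=\inf\{\mathrm{area}(A)+(1-\alpha)\int_0^\infty f+(1-\beta)\int_0^\infty g\}$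 over all $(A,f,g)$ with $A$ compact E-spanning for $(\widetilde{\mathcal Z},f,g)$. *)

(* Defs.v *)
From Stdlib Require Import Reals Lra.
Open Scope R_scope.

Definition pt := (R * R)%type.
Definition set1 := R -> Prop.
Definition set2 := pt -> Prop.

Definition outer1_le (S : set1) (r : R) : Prop :=
  forall eps, 0 < eps ->
  exists (a b : nat -> R),
    (forall n, a n <= b n) /\
    (forall t, S t -> exists n, a n <= t <= b n) /\
    (forall N, sum_f_R0 (fun n => b n - a n) N <= r + eps).

Definition meas1 (S : set1) (m : R) : Prop :=
  outer1_le S m /\ forall r, r < m -> ~ outer1_le S r.

Definition outer2_le (S : set2) (r : R) : Prop :=
  forall eps, 0 < eps ->
  exists (a1 b1 a2 b2 : nat -> R),
    (forall n, a1 n <= b1 n /\ a2 n <= b2 n) /\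
    (forall p, S p -> exists n, a1 n <= fst p <= b1 n /\ a2 n <= snd p <= b2 n) /\
    (forall N, sum_f_R0 (fun n => (b1 n - a1 n) * (b2 n - a2 n)) N <= r + eps).

Definition area (S : set2) (m : R) : Prop :=
  outer2_le S m /\ forall r, r < m -> ~ outer2_le S r.

Definition subgraph (f : R -> R) : set2 :=
  fun p => 0 <= fst p /\ 0 <= snd p < f (fst p).
Definition integral0inf (f : R -> R) (m : R) : Prop := area (subgraph f) m.

Definition closed2 (A : set2) : Prop :=
  forall p, ~ A p -> exists e, 0 < e /\
    forall q, Rabs (fst q - fst p) < e -> Rabs (snd q - snd p) < e -> ~ A q.
Definition bounded2 (A : set2) : Prop :=
  exists M, forall p, A p -> Rabs (fst p) <= M /\ Rabs (snd p) <= M.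
Definition compact2 (A : set2) : Prop := closed2 A /\ bounded2 A.

Definition quadrant : set2 := fun p => 0 <= fst p /\ 0 <= snd p.

Definition admissible_fun (f : R -> R) : Prop :=
  (forall x, 0 <= x -> 0 <= f x) /\
  (forall x y, 0 <= x -> x <= y -> f y <= f x) /\
  (forall x, 0 < x -> forall e, 0 < e -> exists d, 0 < d /\
       forall y, x - d < y -> y <= x -> Rabs (f y - f x) < e) /\
  (exists M, forall x, M <= x -> f x = 0).

Definition Rect (a b : R) : set2 :=
  fun p => 0 <= fst p <= a /\ 0 <= snd p <= b.

Definition rowset (x : pt) (A : set2) : set1 := fun t => A (t, snd x).
Definition colset (x : pt) (A : set2) : set1 := fun t => A (fst x, t).

(* (row(x,A) + f v, col(x,A) + g u) lies in Z  (both measures finite; if a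
   measure is infinite the pair is not a point of Z, which is a subset of
   [0,oo)^2). *)
Definition pair_in_Z (Z : set2) (f g : R -> R) (A : set2) (x : pt) : Prop :=
  exists m1 m2, meas1 (rowset x A) m1 /\ meas1 (colset x A) m2 /\
                Z (m1 + f (snd x), m2 + g (fst x)).

Definition Top (Z : set2) (f g : R -> R) (A : set2) : set2 :=
  fun x => A x \/ (quadrant x /\ ~ pair_in_Z Z f g A x).

Definition Topn (Z : set2) (f g : R -> R) (n : nat) (A : set2) : set2 :=
  Nat.iter n (Top Z f g) A.

Definition Espans (Z : set2) (f g : R -> R) (A : set2) : Prop :=
  forall x, quadrant x -> exists n, Topn Z f g n A x.

Definition objective_value (alpha beta : R) (Z : set2) (v : R) : Prop :=
  exists (A : set2) (f g : R -> R) (mA mf mg : R),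
    (forall x, A x -> quadrant x) /\ compact2 A /\
    admissible_fun f /\ admissible_fun g /\
    Espans Z f g A /\
    area A mA /\ integral0inf f mf /\ integral0inf g mg /\
    v = mA + (1 - alpha) * mf + (1 - beta) * mg.

Definition Itilde_is (alpha beta : R) (Z : set2) (I : R) : Prop :=
  (forall v, objective_value alpha beta Z v -> I <= v) /\
  (forall eps, 0 < eps -> exists v, objective_value alpha beta Z v /\ v < I + eps).

(* Main.v *)
Require Import Defs.
From Stdlib Require Import Reals Lra Lia ClassicalEpsilon.
From Coquelicot Require Import Compactness Rcomplements.
Open Scope R_scope.

(** Suppose [(A, f, g)] spans for a zero-set containing [Rect p q].  For a set
    [C] of columns and a set [V] of rows consider
    [area (A outside C and V) + (integral of g off C) + (integral of f off V)
     - (p - |C|) * (q - |V|)].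
    Adding to [C] or [V] a line that the dynamics can fill does not increase
    this quantity.  If it is negative for empty [C] and [V], it therefore stays
    negative, so [|C| < p] and [|V| < q] throughout, and the filling stops before
    covering the quadrant.  Hence [area A + mf + mg >= p * q], where [mf] and
    [mg] are the integrals of [f] and [g].

    For the L-shape this gives [area A + mf + mg >= a].  Trading [f, a] for
    [(f - 1)+, a - 1] and [g] for [min (g, 1)] in the arm [Rect a 1],
    symmetrically in the other arm, and adding the two inequalities gives
    [area A + (mf + mg) / 2 >= a - 1].  The convex combination with weights
    [1 - 2 alpha] and [2 alpha] yields the lower bound [a - 2 alpha] for
    [alpha <= 1/2]; for larger [alpha] the claimed lower bound is negative.
    The upper bound comes from [a - 2] diagonal blocks of side slightly above 1
    together with [f = g], each slightly above the indicator of [[0, 1]].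

    Measurability never enters: by compactness [A] and the subgraphs of [f] and
    [g] are replaced by unions of cells of a fine grid. *)

(** * Finite sums and indicators *)

Fixpoint sumR (n : nat) (F : nat -> R) : R :=
  match n with O => 0 | S k => sumR k F + F k end.

Lemma sumR_le (n : nat) (F G : nat -> R) :
  (forall i, (i < n)%nat -> F i <= G i) -> sumR n F <= sumR n G.
Proof.
  induction n as [|n IH]; intros H; simpl; [lra|].
  assert (H1 := H n ltac:(lia)).
  assert (H2 := IH (fun i Hi => H i ltac:(lia))). lra.
Qed.

Lemma sumR_ext (n : nat) (F G : nat -> R) :
  (forall i, (i < n)%nat -> F i = G i) -> sumR n F = sumR n G.
Proof.
  intros H; apply Rle_antisym; apply sumR_le; intros i Hi; rewrite (H i Hi); lra.
Qed.

Lemma sumR_const (n : nat) (c : R) : sumR n (fun _ => c) = INR n * c.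
Proof.
  induction n as [|n IH]; [simpl; lra|]. rewrite S_INR; simpl; rewrite IH; lra.
Qed.

Lemma sumR_nonneg (n : nat) (F : nat -> R) :
  (forall i, (i < n)%nat -> 0 <= F i) -> 0 <= sumR n F.
Proof.
  intros H. assert (H1 := sumR_le n (fun _ => 0) F H). rewrite sumR_const in H1. lra.
Qed.

Lemma sumR_plus (n : nat) (F G : nat -> R) :
  sumR n (fun i => F i + G i) = sumR n F + sumR n G.
Proof. induction n as [|n IH]; simpl; lra. Qed.

Lemma sumR_scal (n : nat) (c : R) (F : nat -> R) :
  sumR n (fun i => c * F i) = c * sumR n F.
Proof. induction n as [|n IH]; simpl; lra. Qed.

Lemma sumR_exchange (n m : nat) (F : nat -> nat -> R) :
  sumR n (fun i => sumR m (fun j => F i j)) = sumR m (fun j => sumR n (fun i => F i j)).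
Proof.
  induction n as [|n IH]; simpl.
  - rewrite sumR_const; lra.
  - rewrite IH, <- sumR_plus. reflexivity.
Qed.

Lemma sumR_widen (K N : nat) (F : nat -> R) :
  (forall n, 0 <= F n) -> (forall n, (N <= n)%nat -> F n = 0) ->
  sumR K F <= sumR N F.
Proof.
  intros Hpos Hz.
  destruct (Nat.le_gt_cases K N) as [H|H].
  - induction H as [|N' HN IH]; [lra|].
    assert (Hm : forall n m, (n <= m)%nat -> sumR n F <= sumR m F).
    { intros n m Hnm; induction Hnm as [|m Hm IHm]; [lra|].
      simpl; specialize (Hpos m); lra. }
    apply Hm; lia.
  - induction H as [|K HK IH]; simpl; rewrite Hz; try lia; lra.
Qed.

Lemma sumR_single (n k : nat) (F : nat -> R) :
  (forall i, 0 <= F i) -> (k < n)%nat -> F k <= sumR n F.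
Proof.
  intros HF Hk; induction n as [|n IH]; [lia|]. simpl.
  assert (0 <= sumR n F) by (apply sumR_nonneg; auto).
  assert (H0 := HF n).
  destruct (Nat.eq_dec k n) as [->|Hne]; [lra|].
  assert (F k <= sumR n F) by (apply IH; lia). lra.
Qed.

Lemma sum_f_R0_sumR (n : nat) (F : nat -> R) : sum_f_R0 F n = sumR (S n) F.
Proof. induction n as [|n IH]; simpl in *; [lra|]. rewrite IH; reflexivity. Qed.

Definition indic (P : Prop) : R := if excluded_middle_informative P then 1 else 0.

Lemma indic_true (P : Prop) : P -> indic P = 1.
Proof. unfold indic; destruct (excluded_middle_informative P); tauto. Qed.

Lemma indic_false (P : Prop) : ~ P -> indic P = 0.
Proof. unfold indic; destruct (excluded_middle_informative P); tauto. Qed.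

Lemma indic_bounds (P : Prop) : 0 <= indic P <= 1.
Proof. unfold indic; destruct (excluded_middle_informative P); lra. Qed.

(** Monotonicity in the second argument lets the maximum of finitely many witnesses serve all
    indices. This later cuts a countable cover down to a finite one. *)
Lemma bounded_witness (N : nat) (P : nat -> nat -> Prop) :
  (forall i L L', (L <= L')%nat -> P i L -> P i L') ->
  (forall i, (i < N)%nat -> exists L, P i L) ->
  exists L, forall i, (i < N)%nat -> P i L.
Proof.
  intros Hmono; induction N as [|N IH]; intros H; [exists O; lia|].
  destruct IH as [L1 H1]; [intros i Hi; apply H; lia|].
  destruct (H N) as [L2 H2]; [lia|].
  exists (max L1 L2); intros i Hi.
  destruct (Nat.eq_dec i N) as [->|Hne].
  - apply (Hmono _ L2); [lia|assumption].
  - apply (Hmono _ L1); [lia|apply H1; lia].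
Qed.

(** * Infima and outer measures *)

Lemma glb_exists (E : R -> Prop) (l : R) :
  (exists r, E r) -> (forall r, E r -> l <= r) ->
  exists m, (forall r, E r -> m <= r) /\
            (forall eps, 0 < eps -> exists r, E r /\ r < m + eps).
Proof.
  intros [r0 Hr0] Hl.
  (* The infimum of [E] is minus the supremum of the reflected set. *)
  destruct (completeness (fun x => E (- x))) as [s [Hs1 Hs2]].
  - exists (- l); intros x Hx; specialize (Hl _ Hx); lra.
  - exists (- r0); rewrite Ropp_involutive; exact Hr0.
  - exists (- s); split.
    + intros r Hr. assert (- r <= s) by (apply Hs1; rewrite Ropp_involutive; exact Hr). lra.
    + intros eps Heps. apply NNPP; intros Hn.
      assert (s <= s - eps); [|lra].
      apply Hs2; intros x Hx. apply Rnot_lt_le; intros Hlt. apply Hn.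
      exists (- x); split; [exact Hx|lra].
Qed.

Lemma outer1_nonneg (S : set1) (r : R) : outer1_le S r -> 0 <= r.
Proof.
  intros H; apply Rnot_lt_le; intros Hr.
  destruct (H (- r / 2)) as (a & b & Hab & _ & Hsum); [lra|].
  specialize (Hsum O); simpl in Hsum; specialize (Hab O); lra.
Qed.

Lemma outer2_nonneg (S : set2) (r : R) : outer2_le S r -> 0 <= r.
Proof.
  intros H; apply Rnot_lt_le; intros Hr.
  destruct (H (- r / 2)) as (a1 & b1 & a2 & b2 & Hab & _ & Hsum); [lra|].
  specialize (Hsum O); simpl in Hsum; specialize (Hab O).
  assert (0 <= (b1 O - a1 O) * (b2 O - a2 O)) by (apply Rmult_le_pos; lra). lra.
Qed.

Lemma outer1_mono (S T : set1) (r : R) :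
  (forall t, S t -> T t) -> outer1_le T r -> outer1_le S r.
Proof.
  intros HST H eps Heps. destruct (H eps Heps) as (a & b & Hab & Hc & Hs).
  exists a, b; repeat split; auto.
Qed.

Lemma outer2_mono (S T : set2) (r : R) :
  (forall t, S t -> T t) -> outer2_le T r -> outer2_le S r.
Proof.
  intros HST H eps Heps. destruct (H eps Heps) as (a1 & b1 & a2 & b2 & Hab & Hc & Hs).
  exists a1, b1, a2, b2; repeat split; auto; apply Hab.
Qed.

(** The slack [eps] built into [outer1_le] makes the infimum of the valid bounds a valid bound: half
    of the slack pays for approaching the infimum, half for the cover. *)
Lemma outer1_glb (S : set1) (m : R) :
  (forall eps, 0 < eps -> exists r, outer1_le S r /\ r < m + eps) -> outer1_le S m.
Proof.
  intros H eps Heps. destruct (H (eps / 2)) as (r & Hr & Hlt); [lra|].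
  destruct (Hr (eps / 2)) as (a & b & Hab & Hc & Hs); [lra|].
  exists a, b; repeat split; auto. intros N; specialize (Hs N); lra.
Qed.

Lemma outer2_glb (S : set2) (m : R) :
  (forall eps, 0 < eps -> exists r, outer2_le S r /\ r < m + eps) -> outer2_le S m.
Proof.
  intros H eps Heps. destruct (H (eps / 2)) as (r & Hr & Hlt); [lra|].
  destruct (Hr (eps / 2)) as (a1 & b1 & a2 & b2 & Hab & Hc & Hs); [lra|].
  exists a1, b1, a2, b2; repeat split; auto; try apply Hab.
  intros N; specialize (Hs N); lra.
Qed.

(** [meas1] is an outer measure, so a finite cover bound alone provides a value. This supplies the
    two measures that [pair_in_Z] asks for. *)
Lemma meas1_exists (S : set1) (r : R) :
  outer1_le S r -> exists m, meas1 S m /\ 0 <= m <= r.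
Proof.
  intros Hr. destruct (glb_exists (outer1_le S) 0) as (m & Hm1 & Hm2).
  - exists r; exact Hr.
  - apply outer1_nonneg.
  - assert (Hm : outer1_le S m) by (apply outer1_glb; exact Hm2).
    exists m; repeat split; auto.
    + intros r' Hlt Hr'; specialize (Hm1 _ Hr'); lra.
    + apply outer1_nonneg with S; exact Hm.
Qed.

Lemma area_exists (S : set2) (r : R) :
  outer2_le S r -> exists m, area S m /\ m <= r.
Proof.
  intros Hr. destruct (glb_exists (outer2_le S) 0) as (m & Hm1 & Hm2).
  - exists r; exact Hr.
  - apply outer2_nonneg.
  - assert (Hm : outer2_le S m) by (apply outer2_glb; exact Hm2).
    exists m; repeat split; auto.
    intros r' Hlt Hr'; specialize (Hm1 _ Hr'); lra.
Qed.

(** * Compact sets on fine grids *)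

(** Half-open, so that for [0 < d] every nonnegative coordinate lies in exactly one cell. *)
Definition cell (d : R) (i : nat) (t : R) : Prop := INR i * d <= t < (INR i + 1) * d.

Definition meets (d : R) (K : set2) (i j : nat) : Prop :=
  exists p, K p /\ cell d i (fst p) /\ cell d j (snd p).

Lemma cell_exists (d t : R) : 0 < d -> 0 <= t -> exists i, cell d i t.
Proof.
  intros Hd Ht. destruct (nfloor_ex (t / d)) as [n [H1 H2]].
  - apply Rmult_le_pos; [exact Ht|]. apply Rlt_le, Rinv_0_lt_compat, Hd.
  - exists n. assert (t = t / d * d) by (field; lra).
    unfold cell; split; rewrite H.
    + apply Rmult_le_compat_r; lra.
    + apply Rmult_lt_compat_r; lra.
Qed.

Lemma cell_lt (d t : R) (i N : nat) : 0 < d -> cell d i t -> t < INR N * d -> (i < N)%nat.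
Proof.
  intros Hd [H1 _] H2. apply INR_lt. apply Rmult_lt_reg_r with d; lra.
Qed.

Lemma cell_unique (d t : R) (i j : nat) : 0 < d -> cell d i t -> cell d j t -> i = j.
Proof.
  intros Hd Hi Hj.
  assert (i < S j)%nat.
  { apply (cell_lt d t); auto. rewrite S_INR; apply Hj. }
  assert (j < S i)%nat.
  { apply (cell_lt d t); auto. rewrite S_INR; apply Hi. }
  lia.
Qed.

Lemma count_inside (d a b : R) (N : nat) : 0 < d -> a <= b ->
  d * sumR N (fun i => indic (a <= INR i * d /\ (INR i + 1) * d <= b)) <= b - a.
Proof.
  intros Hd Hab.
  (* The induction needs the bound truncated at [INR N * d], the end of the first [N] cells. *)
  assert (H : d * sumR N (fun i => indic (a <= INR i * d /\ (INR i + 1) * d <= b))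
              <= Rmax 0 (Rmin b (INR N * d) - a)).
  { induction N as [|N IH].
    - simpl. rewrite Rmult_0_r. apply Rmax_l.
    - cbn [sumR]. rewrite S_INR.
      revert IH; generalize (sumR N (fun i => indic (a <= INR i * d /\ (INR i + 1) * d <= b))).
      intros s IH.
      unfold indic; destruct (excluded_middle_informative _) as [[H1 H2]|Hn].
      + revert IH; unfold Rmax, Rmin; repeat destruct (Rle_dec _ _); nra.
      + revert IH; unfold Rmax, Rmin; repeat destruct (Rle_dec _ _); nra. }
  revert H; unfold Rmax, Rmin; repeat destruct (Rle_dec _ _); lra.
Qed.

Lemma geometric_sum_le (N : nat) : sumR N (fun n => (/ 2) ^ S n) <= 1.
Proof.
  assert (H : sumR N (fun n => (/ 2) ^ S n) = 1 - (/ 2) ^ N).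
  { induction N as [|N IH]; cbn [sumR]; [simpl; lra|]. rewrite IH; simpl; lra. }
  rewrite H. assert (0 < (/ 2) ^ N) by (apply pow_lt; lra). lra.
Qed.

Lemma widen_rectangle (w h e : R) : 0 <= w -> 0 <= h -> 0 < e ->
  exists eta, 0 < eta /\ (w + 2 * eta) * (h + 2 * eta) <= w * h + e.
Proof.
  intros Hw Hh He.
  (* For [t <= 1], widening by [t] on each side costs [2 t (w + h) + 4 t^2 <= t D]. *)
  set (D := 2 * (w + h) + 4).
  exists (Rmin 1 (e / D)).
  assert (HD : 0 < D) by (unfold D; lra).
  assert (H0 : 0 < e / D) by (apply Rdiv_lt_0_compat; lra).
  assert (H1 : Rmin 1 (e / D) * D <= e).
  { replace e with (e / D * D) at 2 by (field; lra).
    apply Rmult_le_compat_r; [lra|apply Rmin_r]. }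
  assert (H2 := Rmin_l 1 (e / D)).
  assert (H3 : 0 < Rmin 1 (e / D)) by (apply Rmin_glb_lt; lra).
  split; [exact H3|].
  revert H1 H2 H3; generalize (Rmin 1 (e / D)); intros t H1 H2 H3.
  assert (t * t <= t) by nra. unfold D in H1; nra.
Qed.

(** Widen each rectangle of a near-optimal cover slightly. By compactness every small enough cell
    meeting [K] lies inside a single widened rectangle, and the cells inside one rectangle have
    total area at most its own. *)
Lemma grid_count (K : set2) (m eps M : R) :
  closed2 K -> (forall p, K p -> 0 <= fst p <= M /\ 0 <= snd p <= M) ->
  outer2_le K m -> 0 < eps ->
  exists d0, 0 < d0 /\ forall d N1 N2, 0 < d < d0 ->
    d * d * sumR N1 (fun i => sumR N2 (fun j => indic (meets d K i j))) <= m + eps.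
Proof.
  intros Hcl HM Hout Heps.
  destruct (Hout (eps / 2)) as (a1 & b1 & a2 & b2 & Hab & Hcov & Hsum); [lra|].
  (* The extra areas form a geometric series with total at most [eps / 2]. *)
  assert (Heta : forall n, { eta | 0 < eta /\
    (b1 n - a1 n + 2 * eta) * (b2 n - a2 n + 2 * eta)
      <= (b1 n - a1 n) * (b2 n - a2 n) + eps / 2 * (/ 2) ^ S n }).
  { intros n. apply constructive_indefinite_description.
    destruct (Hab n). apply widen_rectangle; try lra.
    apply Rmult_lt_0_compat; [lra|apply pow_lt; lra]. }
  set (eta := fun n => proj1_sig (Heta n)).
  assert (Heta0 : forall n, 0 < eta n) by (intros n; apply (proj2_sig (Heta n))).
  assert (Heta1 : forall n, (b1 n - a1 n + 2 * eta n) * (b2 n - a2 n + 2 * eta n)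
      <= (b1 n - a1 n) * (b2 n - a2 n) + eps / 2 * (/ 2) ^ S n)
    by (intros n; apply (proj2_sig (Heta n))).
  clearbody eta; clear Heta.
  (* The square of half-side [2 dl] around [(u, v)] either misses [K] or lies in one widened
     rectangle. The factor 2 leaves room for a point within [dl] of [(u, v)] together with its whole
     cell, of side [d < d0 <= dl]. *)
  set (near := fun u v (dl : posreal) =>
    (forall q, Rabs (fst q - u) < 2 * dl -> Rabs (snd q - v) < 2 * dl -> ~ K q) \/
    exists n, a1 n - eta n <= u - 2 * dl /\ u + 2 * dl <= b1 n + eta n /\
              a2 n - eta n <= v - 2 * dl /\ v + 2 * dl <= b2 n + eta n).
  assert (Hdl : forall u v, { dl : posreal | near u v dl }).
  { intros u v. apply constructive_indefinite_description.
    destruct (excluded_middle_informative (K (u, v))) as [HK|HK].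
    - destruct (Hcov _ HK) as [n Hn]. simpl in Hn.
      assert (Hp : 0 < eta n / 2) by (specialize (Heta0 n); lra).
      exists (mkposreal _ Hp). right; exists n; simpl; lra.
    - destruct (Hcl _ HK) as (e & He & Hq). simpl in Hq.
      assert (Hp : 0 < e / 2) by lra.
      exists (mkposreal _ Hp). left; simpl. intros q H1 H2. apply Hq; lra. }
  destruct (compactness_value_2d 0 M 0 M (fun u v => proj1_sig (Hdl u v))) as [d0 Hd0].
  exists d0; split; [apply cond_pos|]. intros d N1 N2 [Hd Hdd0].
  set (I1 := fun n i => a1 n - eta n <= INR i * d /\ (INR i + 1) * d <= b1 n + eta n).
  set (I2 := fun n j => a2 n - eta n <= INR j * d /\ (INR j + 1) * d <= b2 n + eta n).
  assert (Hin : forall i j, meets d K i j -> exists n, I1 n i /\ I2 n j).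
  { intros i j (p & Hp & Hi & Hj).
    destruct (HM _ Hp) as [Hx Hy].
    (* The compactness statement delivers a centre [(u, v)] only under a double negation, hence the
       classical detour. *)
    apply NNPP; intros Hnot. apply (Hd0 _ _ Hx Hy). intros (u & v & _ & _ & Hu & Hv & Hle).
    apply Hnot.
    destruct (proj2_sig (Hdl u v)) as [Hfar|(n & Hn)].
    - exfalso. apply (Hfar p); auto.
      + assert (H := cond_pos (proj1_sig (Hdl u v))). lra.
      + assert (H := cond_pos (proj1_sig (Hdl u v))). lra.
    - exists n. unfold I1, I2, cell in *.
      apply Rabs_def2 in Hu. apply Rabs_def2 in Hv. lra. }
  (* Only finitely many cells are in play, so the first [L] rectangles suffice for all of them. *)
  destruct (bounded_witness N1 (fun i L => forall j, (j < N2)%nat -> meets d K i j ->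
      exists n, (n < L)%nat /\ I1 n i /\ I2 n j)) as [L HL].
  { intros i L L' HLL H j Hj Hm. destruct (H j Hj Hm) as (n & Hn & H1).
    exists n; split; [lia|exact H1]. }
  { intros i _. apply (bounded_witness N2 (fun j L => meets d K i j ->
      exists n, (n < L)%nat /\ I1 n i /\ I2 n j)).
    - intros j L L' HLL H Hm. destruct (H Hm) as (n & Hn & H1).
      exists n; split; [lia|exact H1].
    - intros j _. destruct (excluded_middle_informative (meets d K i j)) as [Hm|Hm].
      + destruct (Hin _ _ Hm) as [n Hn]. exists (S n); intros _; exists n; split; [lia|exact Hn].
      + exists O; tauto. }
  assert (H1 : sumR N1 (fun i => sumR N2 (fun j => indic (meets d K i j))) <=
    sumR L (fun n => sumR N1 (fun i => indic (I1 n i)) * sumR N2 (fun j => indic (I2 n j)))).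
  { apply Rle_trans with (sumR N1 (fun i => sumR N2 (fun j =>
        sumR L (fun n => indic (I1 n i) * indic (I2 n j))))).
    - apply sumR_le; intros i Hi. apply sumR_le; intros j Hj.
      assert (Hpos : forall n, 0 <= indic (I1 n i) * indic (I2 n j))
        by (intros n; apply Rmult_le_pos; apply indic_bounds).
      destruct (excluded_middle_informative (meets d K i j)) as [Hm|Hm].
      + destruct (HL i Hi j Hj Hm) as (n & Hn & Hi1 & Hi2).
        rewrite (indic_true _ Hm).
        apply Rle_trans with (indic (I1 n i) * indic (I2 n j)).
        * rewrite (indic_true _ Hi1), (indic_true _ Hi2); lra.
        * apply (sumR_single L n (fun n => indic (I1 n i) * indic (I2 n j))); auto.
      + rewrite (indic_false _ Hm). apply sumR_nonneg; auto.
    - apply Req_le.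
      rewrite (sumR_ext N1 _ (fun i => sumR L (fun n => sumR N2 (fun j => indic (I1 n i) * indic (I2 n j)))))
        by (intros i _; apply (sumR_exchange N2 L (fun j n => indic (I1 n i) * indic (I2 n j)))).
      rewrite (sumR_exchange N1 L (fun i n => sumR N2 (fun j => indic (I1 n i) * indic (I2 n j)))).
      apply sumR_ext; intros n _.
      rewrite (sumR_ext N1 _ (fun i => sumR N2 (fun j => indic (I2 n j)) * indic (I1 n i)))
        by (intros i _; rewrite sumR_scal; ring).
      rewrite sumR_scal; ring. }
  apply Rle_trans with (d * d *
    sumR L (fun n => sumR N1 (fun i => indic (I1 n i)) * sumR N2 (fun j => indic (I2 n j)))).
  { apply Rmult_le_compat_l; [nra|exact H1]. }
  rewrite <- sumR_scal.
  apply Rle_trans with (sumR L (fun n => (b1 n - a1 n) * (b2 n - a2 n) + eps / 2 * (/ 2) ^ S n)).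
  { apply sumR_le; intros n _. apply Rle_trans with (2 := Heta1 n).
    destruct (Hab n) as [Hab1 Hab2]. specialize (Heta0 n).
    assert (C1 := count_inside d (a1 n - eta n) (b1 n + eta n) N1 Hd ltac:(lra)).
    assert (C2 := count_inside d (a2 n - eta n) (b2 n + eta n) N2 Hd ltac:(lra)).
    fold (I1 n) in C1. fold (I2 n) in C2.
    change (d * sumR N1 (fun i => indic (I1 n i)) <= b1 n + eta n - (a1 n - eta n)) in C1.
    change (d * sumR N2 (fun i => indic (I2 n i)) <= b2 n + eta n - (a2 n - eta n)) in C2.
    assert (P1 : 0 <= sumR N1 (fun i => indic (I1 n i))) by (apply sumR_nonneg; intros; apply indic_bounds).
    assert (P2 : 0 <= sumR N2 (fun i => indic (I2 n i))) by (apply sumR_nonneg; intros; apply indic_bounds).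
    replace (d * d * (sumR N1 (fun i => indic (I1 n i)) * sumR N2 (fun j => indic (I2 n j))))
      with ((d * sumR N1 (fun i => indic (I1 n i))) * (d * sumR N2 (fun j => indic (I2 n j)))) by ring.
    apply Rmult_le_compat; try (apply Rmult_le_pos; lra); lra. }
  rewrite sumR_plus, sumR_scal.
  assert (G := geometric_sum_le L).
  assert (Hs : sumR L (fun n => (b1 n - a1 n) * (b2 n - a2 n)) <= m + eps / 2).
  { destruct L as [|L'].
    - assert (0 <= m) by (apply outer2_nonneg with K; exact Hout). simpl; lra.
    - rewrite <- sum_f_R0_sumR. apply Hsum. }
  nra.
Qed.

(** * The potential *)

Definition b2r (b : bool) : R := if b then 1 else 0.

Definition insert (C : nat -> bool) (i : nat) : nat -> bool :=
  fun k => if Nat.eqb k i then true else C k.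

(** Stated for any [h] because it is used both for sums over [C] and for sums over its
    complement. *)
Lemma sumR_insert (h : bool -> R) (N i : nat) (C : nat -> bool) (X : nat -> R) :
  (i < N)%nat ->
  sumR N (fun k => h (insert C i k) * X k)
    = sumR N (fun k => h (C k) * X k) + (h true - h (C i)) * X i.
Proof.
  intros Hi. assert (Hlt : forall n, (n <= i)%nat ->
    sumR n (fun k => h (insert C i k) * X k) = sumR n (fun k => h (C k) * X k)).
  { intros n Hn; apply sumR_ext; intros k Hk. unfold insert.
    destruct (Nat.eqb_spec k i); [lia|reflexivity]. }
  induction Hi as [|N HN IH]; simpl.
  - rewrite Hlt by lia. unfold insert; rewrite Nat.eqb_refl; ring.
  - rewrite IH. unfold insert at 1. destruct (Nat.eqb_spec N i); [lia|ring].
Qed.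

Definition card (N : nat) (C : nat -> bool) : R := sumR N (fun k => b2r (C k)).

Lemma card_insert (N i : nat) (C : nat -> bool) :
  (i < N)%nat -> C i = false -> card N (insert C i) = card N C + 1.
Proof.
  intros Hi HC. assert (H := sumR_insert b2r N i C (fun _ => 1) Hi).
  rewrite HC in H; simpl in H. unfold card.
  rewrite (sumR_ext N (fun k => b2r (C k)) (fun k => b2r (C k) * 1)) by (intros; ring).
  rewrite (sumR_ext N _ (fun k => b2r (insert C i k) * 1)) by (intros; ring). lra.
Qed.

Lemma card_le (N : nat) (C : nat -> bool) : card N C <= INR N.
Proof.
  rewrite <- (Rmult_1_r (INR N)), <- sumR_const.
  apply sumR_le; intros i _; destruct (C i); simpl; lra.
Qed.

(* Measure of the part of column [i] outside the rows in [V]. *)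
Definition rest (d : R) (N : nat) (al : nat -> nat -> R) (V : nat -> bool) (i : nat) : R :=
  d * sumR N (fun j => b2r (negb (V j)) * al i j).

(** Discrete form of the quantity described at the start: [al i j] weighs the cell in column [i] and
    row [j], and its area factor [d * d] comes half from here and half from [rest]. *)
Definition potential (d : R) (N : nat) (al : nat -> nat -> R) (f g : nat -> R) (p q : R)
    (C V : nat -> bool) : R :=
  d * sumR N (fun i => b2r (negb (C i)) * (rest d N al V i + g i))
  + d * sumR N (fun j => b2r (negb (V j)) * f j)
  - (p - d * card N C) * (q - d * card N V).

(** Swapping the axes reduces the absorption of a row to that of a column. *)
Lemma potential_transpose (d : R) (N : nat) (al : nat -> nat -> R) (f g : nat -> R) (p q : R)
    (C V : nat -> bool) :
  potential d N al f g p q C V = potential d N (fun i j => al j i) g f q p V C.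
Proof.
  unfold potential, rest.
  rewrite (sumR_ext N
    (fun i => b2r (negb (C i)) * (d * sumR N (fun j => b2r (negb (V j)) * al i j) + g i))
    (fun i => d * sumR N (fun j => b2r (negb (C i)) * (b2r (negb (V j)) * al i j))
              + b2r (negb (C i)) * g i)) by (intros i _; rewrite (sumR_scal N (b2r (negb (C i)))); ring).
  rewrite (sumR_ext N
    (fun i => b2r (negb (V i)) * (d * sumR N (fun j => b2r (negb (C j)) * al j i) + f i))
    (fun i => d * sumR N (fun j => b2r (negb (V i)) * (b2r (negb (C j)) * al j i))
              + b2r (negb (V i)) * f i)) by (intros i _; rewrite (sumR_scal N (b2r (negb (V i)))); ring).
  rewrite !sumR_plus, !sumR_scal, sumR_exchange.
  rewrite (sumR_ext N
    (fun j => sumR N (fun i => b2r (negb (C i)) * (b2r (negb (V j)) * al i j)))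
    (fun i => sumR N (fun j => b2r (negb (V i)) * (b2r (negb (C j)) * al j i))))
    by (intros i _; apply sumR_ext; intros; ring).
  ring.
Qed.

(** The two size conditions travel with the sign condition because a product of two negative factors
    would also be positive. *)
Definition good (d : R) (N : nat) (al : nat -> nat -> R) (f g : nat -> R) (p q : R)
    (C V : nat -> bool) : Prop :=
  potential d N al f g p q C V < 0 /\ d * card N C < p /\ d * card N V < q.

Lemma good_transpose (d : R) (N : nat) (al : nat -> nat -> R) (f g : nat -> R) (p q : R)
    (C V : nat -> bool) :
  good d N al f g p q C V -> good d N (fun i j => al j i) g f q p V C.
Proof.
  intros (H1 & H2 & H3). repeat split; auto. rewrite potential_transpose in H1. exact H1.
Qed.

(* Absorbing a column that can be filled does not raise the potential, whose
   only negative term is the product, so negativity keeps both factors positive. *)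
Lemma good_insert (d : R) (N : nat) (al : nat -> nat -> R) (f g : nat -> R) (p q : R)
    (C V : nat -> bool) (i : nat) :
  0 < d -> (forall i j, 0 <= al i j) -> (forall j, 0 <= f j) -> (forall i, 0 <= g i) ->
  (i < N)%nat -> C i = false ->
  q <= rest d N al V i + d * card N V + g i ->
  good d N al f g p q C V -> good d N al f g p q (insert C i) V.
Proof.
  intros Hd Hal Hf Hg Hi HC Hfill (HP & HC1 & HV1).
  assert (HP' : potential d N al f g p q (insert C i) V < 0).
  { unfold potential in *. rewrite card_insert by assumption.
    rewrite (sumR_insert (fun b => b2r (negb b))) by assumption.
    (* The potential changes by [d * (q - d * card N V - rest d N al V i - g i)], which [Hfill]
       makes nonpositive. *)
    rewrite HC; cbn [negb b2r].
    revert HP Hfill; generalize (rest d N al V i) (card N V) (card N C) (g i)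
      (sumR N (fun i => b2r (negb (C i)) * (rest d N al V i + g i)))
      (sumR N (fun j => b2r (negb (V j)) * f j)). intros; nra. }
  repeat split; auto.
  unfold potential in HP'.
  assert (Hn : forall b, 0 <= b2r (negb b)) by (intros []; simpl; lra).
  assert (0 <= sumR N (fun k => b2r (negb (insert C i k)) * (rest d N al V k + g k))).
  { apply sumR_nonneg; intros k _. apply Rmult_le_pos; [apply Hn|].
    apply Rplus_le_le_0_compat; [|apply Hg].
    apply Rmult_le_pos; [lra|]. apply sumR_nonneg; intros; apply Rmult_le_pos; auto. }
  assert (0 <= sumR N (fun j => b2r (negb (V j)) * f j)).
  { apply sumR_nonneg; intros; apply Rmult_le_pos; auto. }
  assert (0 < (p - d * card N (insert C i)) * (q - d * card N V)) by nra.
  nra.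
Qed.

(** Greedy absorption, starting from no lines, preserves [good] and must stop because the grid is
    finite. When it stops, no remaining line can be filled. *)
Lemma stable_exists (d : R) (N : nat) (al : nat -> nat -> R) (f g : nat -> R) (p q : R) :
  0 < d -> (forall i j, 0 <= al i j) -> (forall j, 0 <= f j) -> (forall i, 0 <= g i) ->
  0 < p -> 0 < q ->
  d * d * sumR N (fun i => sumR N (fun j => al i j)) + d * sumR N f + d * sumR N g < p * q ->
  exists C V, d * card N C < p /\ d * card N V < q /\
    (forall i, (i < N)%nat -> C i = false -> rest d N al V i + d * card N V + g i < q) /\
    (forall j, (j < N)%nat -> V j = false ->
       rest d N (fun i j => al j i) C j + d * card N C + f j < p).
Proof.
  intros Hd Hal Hf Hg Hp Hq Hlt.
  (* Induction on fuel [n] exceeding the number of lines not yet absorbed. *)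
  assert (Hind : forall n C V, 2 * INR N - card N C - card N V < INR n ->
    good d N al f g p q C V -> exists C V, d * card N C < p /\ d * card N V < q /\
    (forall i, (i < N)%nat -> C i = false -> rest d N al V i + d * card N V + g i < q) /\
    (forall j, (j < N)%nat -> V j = false ->
       rest d N (fun i j => al j i) C j + d * card N C + f j < p)).
  { induction n as [|n IH]; intros C V Hn Hgood.
    { assert (H1 := card_le N C). assert (H2 := card_le N V). simpl in Hn; lra. }
    rewrite S_INR in Hn.
    destruct (excluded_middle_informative (exists i, (i < N)%nat /\ C i = false /\
      q <= rest d N al V i + d * card N V + g i)) as [(i & Hi & HC & Hfill)|HnoC].
    { apply (IH (insert C i) V); [rewrite card_insert by assumption; lra|].
      apply good_insert; assumption. }
    destruct (excluded_middle_informative (exists j, (j < N)%nat /\ V j = false /\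
      p <= rest d N (fun i j => al j i) C j + d * card N C + f j)) as [(j & Hj & HV & Hfill)|HnoV].
    { apply (IH C (insert V j)); [rewrite card_insert by assumption; lra|].
      apply good_transpose. apply good_insert; auto. apply good_transpose; assumption. }
    exists C, V. destruct Hgood as (_ & H1 & H2). repeat split; auto.
    - intros i Hi HC; apply Rnot_le_lt; intros Hle; apply HnoC; exists i; auto.
    - intros j Hj HV; apply Rnot_le_lt; intros Hle; apply HnoV; exists j; auto. }
  destruct (nfloor_ex (2 * INR N)) as [n [_ Hn]].
  { assert (H := pos_INR N); lra. }
  assert (H0 : card N (fun _ => false) = 0) by (unfold card; simpl; rewrite sumR_const; ring).
  (* For empty sets the potential is the total cost minus [p * q], negative by hypothesis. *)
  apply (Hind (S n) (fun _ => false) (fun _ => false)).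
  - rewrite H0, S_INR; lra.
  - unfold good; rewrite H0. repeat split; try lra.
    unfold potential, rest; rewrite H0; cbn [negb b2r].
    rewrite (sumR_ext N _ (fun i => d * sumR N (fun j => al i j) + g i)).
    2:{ intros i _. rewrite (sumR_ext N (fun j => 1 * al i j) (fun j => al i j)) by (intros; ring). ring. }
    rewrite (sumR_ext N (fun j => 1 * f j) f) by (intros; ring).
    rewrite sumR_plus, sumR_scal. lra.
Qed.

(** * Lower bound for spanning configurations *)

Lemma outer1_cells (d : R) (N : nat) (Q : nat -> Prop) : 0 < d ->
  outer1_le (fun t => exists i, (i < N)%nat /\ Q i /\ cell d i t)
            (d * sumR N (fun i => indic (Q i))).
Proof.
  intros Hd eps Heps.
  (* Unselected indices receive degenerate intervals of length zero. *)
  exists (fun n => INR n * d), (fun n => INR n * d + d * indic ((n < N)%nat /\ Q n)).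
  assert (Hb := fun n => indic_bounds ((n < N)%nat /\ Q n)).
  repeat split.
  - intros n; specialize (Hb n); nra.
  - intros t (i & Hi & HQ & Hc). exists i. rewrite indic_true by auto. unfold cell in Hc; lra.
  - intros K. rewrite sum_f_R0_sumR.
    rewrite (sumR_ext _ _ (fun n => d * indic ((n < N)%nat /\ Q n))) by (intros; ring).
    rewrite sumR_scal.
    assert (sumR (S K) (fun n => indic ((n < N)%nat /\ Q n)) <= sumR N (fun i => indic (Q i))); [|nra].
    apply Rle_trans with (sumR N (fun n => indic ((n < N)%nat /\ Q n))).
    + apply sumR_widen; [intros; apply Hb|]. intros n Hn; apply indic_false; lia.
    + apply Req_le, sumR_ext; intros i Hi. unfold indic.
      destruct (excluded_middle_informative _); destruct (excluded_middle_informative _); tauto.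
Qed.

(** Each row counted on the left is counted on the right once, through [card] if it is in [V] and
    through [rest] otherwise. *)
Lemma rest_union (d : R) (N : nat) (Q : nat -> nat -> Prop) (V : nat -> bool) (i : nat) :
  0 < d ->
  d * sumR N (fun j => indic (V j = true \/ Q i j))
    <= rest d N (fun i j => indic (Q i j)) V i + d * card N V.
Proof.
  intros Hd. unfold rest, card. rewrite <- Rmult_plus_distr_l, <- sumR_plus.
  apply Rmult_le_compat_l; [lra|]. apply sumR_le; intros j _.
  assert (H := indic_bounds (Q i j)).
  destruct (V j); cbn [negb b2r].
  - rewrite (indic_true (true = true \/ Q i j)) by auto. lra.
  - destruct (excluded_middle_informative (Q i j)) as [HQ|HQ].
    + rewrite !(indic_true) by auto. lra.
    + rewrite !(indic_false) by (try tauto; intros [?|?]; [discriminate|tauto]). lra.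
Qed.

(* [F1] and [G1] lower the boundary functions together with the thresholds
   [P] and [Q]: see the three instances in [spanning_cost]. *)
Lemma spanning_grid_bound (Z A : set2) (f g F1 G1 : R -> R) (P Q p q d : R) (N : nat) :
  (forall x, Rect P Q x -> Z x) ->
  (forall x, A x -> quadrant x) ->
  (forall x, A x -> fst x < INR N * d /\ snd x < INR N * d) ->
  (forall x, 0 <= x -> 0 <= f x) -> (forall x, 0 <= x -> 0 <= g x) ->
  (forall x y, 0 <= x -> x <= y -> f y <= f x) ->
  (forall x y, 0 <= x -> x <= y -> g y <= g x) ->
  (forall x, INR N * d <= x -> f x = 0) -> (forall x, INR N * d <= x -> g x = 0) ->
  (forall y, 0 <= y -> 0 <= F1 y) -> (forall y, 0 <= y -> 0 <= G1 y) ->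
  F1 0 = 0 -> G1 0 = 0 ->
  (forall s y, 0 <= s -> 0 <= y -> s + F1 y < p -> s + y <= P) ->
  (forall s y, 0 <= s -> 0 <= y -> s + G1 y < q -> s + y <= Q) ->
  0 < p -> 0 < q -> 0 < d ->
  Espans Z f g A ->
  p * q <= d * d * sumR N (fun i => sumR N (fun j => indic (meets d A i j)))
           + d * sumR N (fun j => F1 (f (INR j * d))) + d * sumR N (fun i => G1 (g (INR i * d))).
Proof.
  intros HZ HAq HAb Hf Hg Hfm Hgm Hf0 Hg0 HF1 HG1 HF10 HG10 HFp HGq Hp Hq Hd Hspan.
  assert (Hid : forall i, 0 <= INR i * d) by (intros i; apply Rmult_le_pos; [apply pos_INR|lra]).
  apply Rnot_lt_le; intros Hlt.
  destruct (stable_exists d N (fun i j => indic (meets d A i j))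
    (fun j => F1 (f (INR j * d))) (fun i => G1 (g (INR i * d))) p q)
    as (C & V & HC & HV & HsC & HsV); auto.
  { intros; apply indic_bounds. }
  assert (Hbig : forall i, (N <= i)%nat -> INR N * d <= INR i * d).
  { intros i Hi. apply Rmult_le_compat_r; [lra|]. apply le_INR; exact Hi. }
  (* Stability extends to columns beyond the grid: no cell there meets [A], and [g] vanishes, so
     only [d * card N V < q] is left. *)
  assert (HsC' : forall i, ((i < N)%nat -> C i = false) ->
    rest d N (fun i j => indic (meets d A i j)) V i + d * card N V + G1 (g (INR i * d)) < q).
  { intros i Hi. destruct (Nat.le_gt_cases N i) as [Hge|Hlt']; [|apply HsC; auto].
    rewrite Hg0, HG10 by auto. unfold rest.
    rewrite (sumR_ext N _ (fun _ => 0)).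
    - rewrite sumR_const; lra.
    - intros j _. rewrite indic_false; [ring|]. intros (x & Hx & Hc & _).
      destruct (HAb _ Hx) as [Hx1 _]. specialize (Hbig i Hge). unfold cell in Hc; lra. }
  assert (HsV' : forall j, ((j < N)%nat -> V j = false) ->
    rest d N (fun j i => indic (meets d A i j)) C j + d * card N C + F1 (f (INR j * d)) < p).
  { intros j Hj. destruct (Nat.le_gt_cases N j) as [Hge|Hlt']; [|apply HsV; auto].
    rewrite Hf0, HF10 by auto. unfold rest.
    rewrite (sumR_ext N _ (fun _ => 0)).
    - rewrite sumR_const; lra.
    - intros i _. rewrite indic_false; [ring|]. intros (x & Hx & _ & Hc).
      destruct (HAb _ Hx) as [_ Hx1]. specialize (Hbig j Hge). unfold cell in Hc; lra. }
  (* [B] traps the dynamics: [A] together with all absorbed columns and rows. *)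
  set (B := fun x : pt => quadrant x /\ (A x \/
      (exists i, (i < N)%nat /\ C i = true /\ cell d i (fst x)) \/
      (exists j, (j < N)%nat /\ V j = true /\ cell d j (snd x)))).
  assert (Hinv : forall n x, Topn Z f g n A x -> B x).
  { induction n as [|n IH]; intros x Hx.
    { split; [apply HAq; exact Hx|left; exact Hx]. }
    change (Top Z f g (Topn Z f g n A) x) in Hx.
    destruct Hx as [Hx|[Hxq Hnot]]; [apply IH; exact Hx|].
    (* A point outside [B] lies on an unabsorbed row and an unabsorbed column. Their stability puts
       the pair of measures in [Rect P Q], so the point is not added. *)
    apply NNPP; intros HB. apply Hnot. destruct Hxq as [Hu Hv].
    destruct (cell_exists d (fst x) Hd Hu) as [i Hi].
    destruct (cell_exists d (snd x) Hd Hv) as [j Hj].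
    assert (HCi : (i < N)%nat -> C i = false).
    { intros HiN. apply Bool.not_true_is_false; intros HCt. apply HB. split; [split; auto|].
      right; left; exists i; auto. }
    assert (HVj : (j < N)%nat -> V j = false).
    { intros HjN. apply Bool.not_true_is_false; intros HVt. apply HB. split; [split; auto|].
      right; right; exists j; auto. }
    destruct (meas1_exists (rowset x (Topn Z f g n A))
      (d * sumR N (fun i => indic (C i = true \/ meets d A i j)))) as (m1 & Hm1 & Hm1p & Hm1le).
    { apply outer1_mono with (2 := outer1_cells d N (fun i => C i = true \/ meets d A i j) Hd).
      intros t Ht. apply IH in Ht. destruct Ht as [[Ht0 _] [HA|[(k & Hk & HCk & Hc)|(k & Hk & HVk & Hc)]]];
        simpl in *.
      - destruct (cell_exists d t Hd Ht0) as [k Hk]. exists k. split; [|split; auto].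
        + apply (cell_lt d t); auto. apply (HAb _ HA).
        + right. exists (t, snd x); auto.
      - exists k; auto.
      - exfalso. assert (k = j) by (apply (cell_unique d (snd x)); auto). subst k.
        rewrite HVj in HVk by assumption; discriminate. }
    destruct (meas1_exists (colset x (Topn Z f g n A))
      (d * sumR N (fun j => indic (V j = true \/ meets d A i j)))) as (m2 & Hm2 & Hm2p & Hm2le).
    { apply outer1_mono with (2 := outer1_cells d N (fun j => V j = true \/ meets d A i j) Hd).
      intros t Ht. apply IH in Ht. destruct Ht as [[_ Ht0] [HA|[(k & Hk & HCk & Hc)|(k & Hk & HVk & Hc)]]];
        simpl in *.
      - destruct (cell_exists d t Hd Ht0) as [k Hk]. exists k. split; [|split; auto].
        + apply (cell_lt d t); auto. apply (HAb _ HA).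
        + right. exists (fst x, t); auto.
      - exfalso. assert (k = i) by (apply (cell_unique d (fst x)); auto). subst k.
        rewrite HCi in HCk by assumption; discriminate.
      - exists k; auto. }
    assert (R1 := rest_union d N (fun j i => meets d A i j) C j Hd).
    assert (R2 := rest_union d N (fun i j => meets d A i j) V i Hd).
    specialize (HsC' i HCi). specialize (HsV' j HVj). cbv beta in *.
    assert (E1 : m1 + f (INR j * d) <= P) by (apply HFp; auto; lra).
    assert (E2 : m2 + g (INR i * d) <= Q) by (apply HGq; auto; lra).
    (* Stability is known at the left endpoint of the cell; monotonicity carries it to the point
       itself. *)
    assert (E3 := Hfm (INR j * d) (snd x) (Hid j) (proj1 Hj)).
    assert (E4 := Hgm (INR i * d) (fst x) (Hid i) (proj1 Hi)).
    assert (E5 := Hf _ Hv). assert (E6 := Hg _ Hu).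
    exists m1, m2. split; [exact Hm1|split; [exact Hm2|]]. apply HZ. unfold Rect; simpl; lra. }
  (* This corner lies beyond [A] and in the cell of index [N] on both axes, hence outside [B]. *)
  destruct (Hspan (INR N * d, INR N * d)) as [n Hn]; [split; simpl; apply Hid|].
  apply Hinv in Hn. destruct Hn as [_ [HA|[(k & Hk & _ & Hc)|(k & Hk & _ & Hc)]]].
  - apply HAb in HA; simpl in HA; lra.
  - simpl in Hc. assert (k = N); [|lia]. apply (cell_unique d (INR N * d)); auto. unfold cell; nra.
  - simpl in Hc. assert (k = N); [|lia]. apply (cell_unique d (INR N * d)); auto. unfold cell; nra.
Qed.

(** * Left-endpoint Riemann sums of the boundary functions *)

Lemma count_below (d x : R) (N : nat) : 0 < d ->
  Rmin x (INR N * d) <= d * sumR N (fun j => indic (INR j * d <= x)).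
Proof.
  intros Hd. induction N as [|N IH].
  - simpl. rewrite Rmult_0_l, Rmult_0_r. apply Rmin_r.
  - cbn [sumR]. rewrite S_INR.
    revert IH; generalize (sumR N (fun j => indic (INR j * d <= x))); intros s IH.
    unfold indic; destruct (excluded_middle_informative _);
    revert IH; unfold Rmin; repeat destruct (Rle_dec _ _); nra.
Qed.

(** Left-endpoint sums of a nonincreasing function overestimate its integral. The excess is
    controlled by applying [grid_count] to the subgraph lowered by [eta]; over a length at most [M]
    the lowering costs at most [eps / 2]. *)
Lemma upper_riemann_sum_le (f : R -> R) (m M eps : R) :
  admissible_fun f -> integral0inf f m -> 0 < M -> 0 < eps ->
  exists d0, 0 < d0 /\ forall d N, 0 < d < d0 -> INR N * d <= M ->
    d * sumR N (fun i => f (INR i * d)) <= m + eps.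
Proof.
  intros (Hpos & Hmono & Hleft & (M0 & HM0)) [Hint _] HM Heps.
  set (eta := eps / (2 * M)).
  assert (Heta : 0 < eta) by (apply Rdiv_lt_0_compat; lra).
  assert (HetaM : M * eta = eps / 2) by (unfold eta; field; lra).
  (* The non-strict inequality makes [K] closed, and [eta > 0] keeps it inside the strict
     subgraph. *)
  set (K := fun x : pt => 0 <= fst x /\ 0 <= snd x /\ snd x + eta <= f (fst x)).
  assert (Hcl : closed2 K).
  { intros [u h] HnK. unfold K in HnK; simpl in HnK.
    destruct (Rlt_le_dec u 0) as [Hu|Hu].
    { exists (- u); split; [lra|]. intros q Hq _ (H & _). simpl in *.
      apply Rabs_def2 in Hq; lra. }
    destruct (Rlt_le_dec h 0) as [Hh|Hh].
    { exists (- h); split; [lra|]. intros q _ Hq (_ & H & _). simpl in *.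
      apply Rabs_def2 in Hq; lra. }
    assert (Hgap : f u < h + eta) by (apply Rnot_le_lt; intros H; apply HnK; auto).
    set (e := (h + eta - f u) / 2). assert (He : 0 < e) by (unfold e; lra).
    (* Upper semicontinuity: left continuity handles points to the left of [u], monotonicity those
       to the right. *)
    assert (Hd : exists dl, 0 < dl /\ forall y, 0 <= y -> u - dl < y -> f y < f u + e).
    { destruct (Rle_lt_or_eq_dec 0 u Hu) as [Hu'|Hu'].
      - destruct (Hleft u Hu' e He) as (dl & Hdl & Hy). exists dl; split; [exact Hdl|].
        intros y Hy0 Hyu. destruct (Rle_lt_dec y u) as [Hle|Hgt].
        + specialize (Hy y Hyu Hle). apply Rabs_def2 in Hy; lra.
        + assert (f y <= f u) by (apply Hmono; lra). lra.
      - exists 1; split; [lra|]. intros y Hy0 _.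
        assert (f y <= f u) by (apply Hmono; lra). lra. }
    destruct Hd as (dl & Hdl & Hy).
    exists (Rmin dl e). split; [apply Rmin_glb_lt; assumption|].
    intros q Hq1 Hq2 (Hq3 & _ & Hq4). simpl in *.
    assert (B1 := Rmin_l dl e). assert (B2 := Rmin_r dl e).
    apply Rabs_def2 in Hq1. apply Rabs_def2 in Hq2.
    specialize (Hy (fst q) Hq3 ltac:(lra)). unfold e in *; lra. }
  set (B := Rmax M0 (f 0)).
  assert (HB : forall p, K p -> 0 <= fst p <= B /\ 0 <= snd p <= B).
  { intros p (H1 & H2 & H3).
    assert (f (fst p) <= f 0) by (apply Hmono; lra).
    assert (B1 := Rmax_l M0 (f 0)). assert (B2 := Rmax_r M0 (f 0)). fold B in B1, B2.
    repeat split; try lra.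
    apply Rnot_lt_le; intros Hlt. rewrite (HM0 (fst p)) in H3; lra. }
  assert (Hout : outer2_le K m).
  { apply outer2_mono with (2 := Hint). intros x (H1 & H2 & H3). unfold subgraph; lra. }
  destruct (grid_count K m (eps / 2) B Hcl HB Hout ltac:(lra)) as (d0 & Hd0 & Hcount).
  exists d0; split; [exact Hd0|]. intros d N Hd HN.
  destruct (nfloor_ex (f 0 / d)) as [n [_ Hn]].
  { apply Rmult_le_pos; [apply Hpos; lra|]. apply Rlt_le, Rinv_0_lt_compat; lra. }
  assert (HN2 : f 0 <= INR (S n) * d).
  { rewrite S_INR. replace (f 0) with (f 0 / d * d) by (field; lra).
    apply Rmult_le_compat_r; lra. }
  specialize (Hcount d N (S n) Hd).
  (* In column [i] every corner [(INR i * d, INR j * d)] of height at most [f (INR i * d) - eta]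
     belongs to [K], so its cell is counted. *)
  assert (Hlow : sumR N (fun i => f (INR i * d) - eta) <=
     d * sumR N (fun i => sumR (S n) (fun j => indic (meets d K i j)))).
  { rewrite <- sumR_scal. apply sumR_le; intros i _.
    assert (Hi : 0 <= INR i * d) by (apply Rmult_le_pos; [apply pos_INR|lra]).
    assert (Hfi : f (INR i * d) <= f 0) by (apply Hmono; lra).
    apply Rle_trans with (d * sumR (S n) (fun j => indic (INR j * d <= f (INR i * d) - eta))).
    - eapply Rle_trans; [|apply count_below; lra]. apply Rmin_glb; lra.
    - apply Rmult_le_compat_l; [lra|]. apply sumR_le; intros j _.
      destruct (excluded_middle_informative (INR j * d <= f (INR i * d) - eta)) as [H|H].
      + rewrite (indic_true _ H), indic_true; [lra|].
        assert (Hj : 0 <= INR j * d) by (apply Rmult_le_pos; [apply pos_INR|lra]).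
        exists (INR i * d, INR j * d). unfold K, cell; simpl. repeat split; nra.
      + rewrite (indic_false _ H). apply indic_bounds. }
  rewrite (sumR_ext N _ (fun i => f (INR i * d) + - eta)) in Hlow by (intros; ring).
  rewrite sumR_plus, sumR_const in Hlow.
  assert (d * (sumR N (fun i => f (INR i * d)) + INR N * - eta) <= m + eps / 2) by nra.
  nra.
Qed.

(** * The two cost inequalities for the L-shape *)

Definition Lshape (a : R) : set2 := fun p => Rect a 1 p \/ Rect 1 a p.

Lemma spanning_cost_approx (a eps : R) (A : set2) (f g : R -> R) (mA mf mg : R) :
  1 < a -> 0 < eps -> (forall x, A x -> quadrant x) -> compact2 A ->
  admissible_fun f -> admissible_fun g -> Espans (Lshape a) f g A ->
  area A mA -> integral0inf f mf -> integral0inf g mg ->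
  a <= mA + mf + mg + 3 * eps /\ 2 * (a - 1) <= 2 * mA + mf + mg + 4 * eps.
Proof.
  intros Ha Heps HAq [HAcl [MA HMA]] Hf Hg Hspan [HA _] Hmf Hmg.
  pose proof Hf as (Hf1 & Hf2 & Hf3 & Mf & HMf).
  pose proof Hg as (Hg1 & Hg2 & Hg3 & Mg & HMg).
  set (M := Rmax (MA + 1) (Rmax 1 (Rmax Mf Mg))).
  assert (MB : MA + 1 <= M /\ 1 <= M /\ Mf <= M /\ Mg <= M).
  { unfold M. assert (B1 := Rmax_l (MA + 1) (Rmax 1 (Rmax Mf Mg))).
    assert (B2 := Rmax_r (MA + 1) (Rmax 1 (Rmax Mf Mg))).
    assert (B3 := Rmax_l 1 (Rmax Mf Mg)). assert (B4 := Rmax_r 1 (Rmax Mf Mg)).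
    assert (B5 := Rmax_l Mf Mg). assert (B6 := Rmax_r Mf Mg). lra. }
  clearbody M.
  assert (HAM : forall p, A p -> 0 <= fst p <= MA /\ 0 <= snd p <= MA).
  { intros p Hp. destruct (HMA p Hp) as [H1 H2]. destruct (HAq p Hp) as [H3 H4].
    rewrite Rabs_pos_eq in H1, H2 by assumption. lra. }
  destruct (grid_count A mA eps MA HAcl HAM HA Heps) as (d1 & Hd1 & HcA).
  destruct (upper_riemann_sum_le f mf (M + 1) eps Hf Hmf ltac:(lra) Heps) as (d2 & Hd2 & Hcf).
  destruct (upper_riemann_sum_le g mg (M + 1) eps Hg Hmg ltac:(lra) Heps) as (d3 & Hd3 & Hcg).
  set (d := Rmin (Rmin 1 d1) (Rmin d2 d3) / 2).
  assert (Hd : 0 < d /\ d < 1 /\ d < d1 /\ d < d2 /\ d < d3).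
  { assert (B1 := Rmin_l (Rmin 1 d1) (Rmin d2 d3)). assert (B2 := Rmin_r (Rmin 1 d1) (Rmin d2 d3)).
    assert (B3 := Rmin_l 1 d1). assert (B4 := Rmin_r 1 d1).
    assert (B5 := Rmin_l d2 d3). assert (B6 := Rmin_r d2 d3).
    assert (0 < Rmin (Rmin 1 d1) (Rmin d2 d3)) by (repeat apply Rmin_glb_lt; lra).
    unfold d; lra. }
  clearbody d. destruct Hd as (Hd0 & Hdd1 & Hdd2 & Hdd3 & Hdd4).
  destruct (nfloor_ex (M / d)) as [n [Hn1 Hn2]].
  { apply Rmult_le_pos; [lra|]. apply Rlt_le, Rinv_0_lt_compat; lra. }
  (* One cell past the floor makes the grid reach [M]; since [d < 1] it stays below [M + 1]. *)
  set (N := S n).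
  assert (HN : M <= INR N * d <= M + 1).
  { unfold N; rewrite S_INR. assert (E : M = M / d * d) by (field; lra).
    split.
    - rewrite E at 1. apply Rmult_le_compat_r; lra.
    - assert (INR n * d <= M / d * d) by (apply Rmult_le_compat_r; lra). lra. }
  clearbody N.
  specialize (HcA d N N (conj Hd0 Hdd2)).
  specialize (Hcf d N (conj Hd0 Hdd3) (proj2 HN)).
  specialize (Hcg d N (conj Hd0 Hdd4) (proj2 HN)).
  assert (HAb : forall x, A x -> fst x < INR N * d /\ snd x < INR N * d).
  { intros x Hx. destruct (HAM x Hx); lra. }
  assert (Hf0 : forall x, INR N * d <= x -> f x = 0) by (intros; apply HMf; lra).
  assert (Hg0 : forall x, INR N * d <= x -> g x = 0) by (intros; apply HMg; lra).
  assert (B1 : a * 1 <= d * d * sumR N (fun i => sumR N (fun j => indic (meets d A i j)))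
    + d * sumR N (fun j => f (INR j * d)) + d * sumR N (fun i => g (INR i * d))).
  { apply (spanning_grid_bound (Lshape a) A f g (fun y => y) (fun y => y) a 1); auto;
      try lra; try (intros; lra). intros x Hx; left; exact Hx. }
  (* The truncations are legitimate: [s + max (y - 1, 0) < a - 1] gives [s + y < a], and
     [s + min (y, 1) < 1] forces [y < 1], so the minimum is [y]. *)
  assert (B2 : (a - 1) * 1 <= d * d * sumR N (fun i => sumR N (fun j => indic (meets d A i j)))
    + d * sumR N (fun j => Rmax (f (INR j * d) - 1) 0)
    + d * sumR N (fun i => Rmin (g (INR i * d)) 1)).
  { apply (spanning_grid_bound (Lshape a) A f g (fun y => Rmax (y - 1) 0) (fun y => Rmin y 1) a 1);
      auto; try lra; try (intros; unfold Rmax, Rmin in *; destruct (Rle_dec _ _); lra).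
    intros x Hx; left; exact Hx. }
  assert (B3 : 1 * (a - 1) <= d * d * sumR N (fun i => sumR N (fun j => indic (meets d A i j)))
    + d * sumR N (fun j => Rmin (f (INR j * d)) 1)
    + d * sumR N (fun i => Rmax (g (INR i * d) - 1) 0)).
  { apply (spanning_grid_bound (Lshape a) A f g (fun y => Rmin y 1) (fun y => Rmax (y - 1) 0) 1 a);
      auto; try lra; try (intros; unfold Rmax, Rmin in *; destruct (Rle_dec _ _); lra).
    intros x Hx; right; exact Hx. }
  (* Since [h = max (h - 1, 0) + min (h, 1)], adding [B2] and [B3] counts [f] and [g] once and the
     area twice. *)
  assert (Split : forall h : R -> R, sumR N (fun j => h (INR j * d))
    = sumR N (fun j => Rmax (h (INR j * d) - 1) 0) + sumR N (fun j => Rmin (h (INR j * d)) 1)).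
  { intros h. rewrite <- sumR_plus. apply sumR_ext; intros j _.
    unfold Rmax, Rmin; repeat destruct (Rle_dec _ _); lra. }
  split; [lra|]. rewrite (Split f) in Hcf. rewrite (Split g) in Hcg. lra.
Qed.

Lemma spanning_cost (a : R) (A : set2) (f g : R -> R) (mA mf mg : R) :
  1 < a -> (forall x, A x -> quadrant x) -> compact2 A ->
  admissible_fun f -> admissible_fun g -> Espans (Lshape a) f g A ->
  area A mA -> integral0inf f mf -> integral0inf g mg ->
  a <= mA + mf + mg /\ a - 1 <= mA + (mf + mg) / 2.
Proof.
  intros Ha HAq HAc Hf Hg Hspan HA Hmf Hmg.
  (* Taking [eps] as a quarter of the supposed deficit contradicts either approximate inequality. *)
  split; apply Rnot_lt_le; intros Hlt.
  - destruct (spanning_cost_approx a ((a - (mA + mf + mg)) / 4) A f g mA mf mg); auto; lra.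
  - destruct (spanning_cost_approx a ((a - 1 - (mA + (mf + mg) / 2)) / 4) A f g mA mf mg); auto; lra.
Qed.

Lemma objective_lower_bound (a alpha v : R) :
  1 < a -> 0 < alpha <= / 2 -> objective_value alpha alpha (Lshape a) v -> a - 2 * alpha <= v.
Proof.
  intros Ha Hal (A & f & g & mA & mf & mg & HAq & HAc & Hf & Hg & Hspan & HA & Hmf & Hmg & ->).
  destruct (spanning_cost a A f g mA mf mg) as [H1 H2]; auto.
  (* convex combination with weights 1 - 2 alpha and 2 alpha *)
  assert ((1 - 2 * alpha) * a <= (1 - 2 * alpha) * (mA + mf + mg))
    by (apply Rmult_le_compat_l; lra).
  assert (2 * alpha * (a - 1) <= 2 * alpha * (mA + (mf + mg) / 2))
    by (apply Rmult_le_compat_l; lra).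
  nra.
Qed.

Lemma objective_nonneg (alpha v : R) (Z : set2) :
  alpha <= 1 -> objective_value alpha alpha Z v -> 0 <= v.
Proof.
  intros Hal (A & f & g & mA & mf & mg & _ & _ & _ & _ & _ & [HA _] & [Hmf _] & [Hmg _] & ->).
  apply outer2_nonneg in HA, Hmf, Hmg. nra.
Qed.

(** * The block-diagonal configuration *)

Lemma count_touching (d x y : R) (N : nat) : 0 < d -> 0 <= x <= y ->
  Rmin y (INR N * d) - x <= d * sumR N (fun i => indic (INR i * d <= y /\ x < (INR i + 1) * d)).
Proof.
  intros Hd Hxy.
  assert (Hpos : forall N, 0 <= sumR N (fun i => indic (INR i * d <= y /\ x < (INR i + 1) * d)))
    by (intros; apply sumR_nonneg; intros; apply indic_bounds).
  induction N as [|N IH].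
  - simpl. rewrite Rmult_0_l. assert (H := Rmin_r y 0). lra.
  - cbn [sumR]. rewrite S_INR. specialize (Hpos N).
    revert IH Hpos; generalize (sumR N (fun i => indic (INR i * d <= y /\ x < (INR i + 1) * d))).
    intros s IH Hpos.
    unfold indic; destruct (excluded_middle_informative _) as [H|H].
    + revert IH; unfold Rmin; repeat destruct (Rle_dec _ _); nra.
    + destruct (Rlt_le_dec y (INR N * d)).
      * revert IH; unfold Rmin; repeat destruct (Rle_dec _ _); nra.
      * assert ((INR N + 1) * d <= x) by (apply Rnot_lt_le; intros ?; apply H; auto).
        assert (Hm := Rmin_r y ((INR N + 1) * d)). nra.
Qed.

Lemma closed2_box (a b c e : R) :
  closed2 (fun p => a <= fst p <= b /\ c <= snd p <= e).
Proof.
  intros [u v] Hn; simpl in Hn.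
  destruct (Rlt_le_dec u a) as [H1|H1]; [exists (a - u)|
  destruct (Rlt_le_dec b u) as [H2|H2]; [exists (u - b)|
  destruct (Rlt_le_dec v c) as [H3|H3]; [exists (c - v)|
  destruct (Rlt_le_dec e v) as [H4|H4]; [exists (v - e)|lra]]]];
  (split; [lra|]); intros q Hq1 Hq2 Hq; simpl in *;
  apply Rabs_def2 in Hq1; apply Rabs_def2 in Hq2; lra.
Qed.

(** Thickening [[x, y]] to the rectangle [[x, y] x [0, 1]] turns a cover of [S] into a planar cover
    with the same sum, so [grid_count] applies; the cells meeting the rectangle are then counted
    from below. *)
Lemma interval_outer1 (S : set1) (x y r : R) :
  0 <= x <= y -> (forall t, x <= t <= y -> S t) -> outer1_le S r -> y - x <= r.
Proof.
  intros Hxy HS Hr. apply Rnot_lt_le; intros Hlt.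
  set (K := fun p : pt => x <= fst p <= y /\ 0 <= snd p <= 1).
  assert (HK : outer2_le K r).
  { intros eps Heps. destruct (Hr eps Heps) as (a & b & Hab & Hc & Hs).
    exists a, b, (fun _ => 0), (fun _ => 1). split; [intros n; specialize (Hab n); lra|split].
    - intros p [Hp1 Hp2]. destruct (Hc (fst p)) as [n Hn]; [apply HS; exact Hp1|].
      exists n; auto.
    - intros N. specialize (Hs N). rewrite sum_f_R0_sumR in *.
      rewrite (sumR_ext _ _ (fun n => b n - a n)) by (intros; ring). exact Hs. }
  destruct (grid_count K r ((y - x - r) / 2) (Rmax y 1)) as (d0 & Hd0 & Hc); try lra; auto.
  { apply closed2_box. }
  { intros p [H1 H2]. assert (B1 := Rmax_l y 1). assert (B2 := Rmax_r y 1). lra. }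
  set (d := d0 / 2). assert (Hd : 0 < d < d0) by (unfold d; lra). clearbody d.
  destruct (nfloor_ex ((y + 1) / d)) as [n [_ Hn]].
  { apply Rmult_le_pos; [lra|]. apply Rlt_le, Rinv_0_lt_compat; lra. }
  assert (HN : y + 1 <= INR (Datatypes.S n) * d).
  { rewrite S_INR. replace (y + 1) with ((y + 1) / d * d) by (field; lra).
    apply Rmult_le_compat_r; lra. }
  set (N := Datatypes.S n) in *. clearbody N.
  specialize (Hc d N N Hd).
  assert (C1 := count_touching d x y N (proj1 Hd) Hxy).
  assert (C2 := count_below d 1 N (proj1 Hd)).
  rewrite Rmin_left in C1 by lra. rewrite Rmin_left in C2 by lra.
  set (s1 := sumR N (fun i => indic (INR i * d <= y /\ x < (INR i + 1) * d))) in *.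
  set (s2 := sumR N (fun j => indic (INR j * d <= 1))) in *.
  assert (Hs : s1 * s2 <= sumR N (fun i => sumR N (fun j => indic (meets d K i j)))).
  { unfold s1. rewrite Rmult_comm, <- sumR_scal. apply sumR_le; intros i _.
    rewrite Rmult_comm. unfold s2. rewrite <- sumR_scal. apply sumR_le; intros j _.
    destruct (excluded_middle_informative (INR i * d <= y /\ x < (INR i + 1) * d)) as [Hi|Hi].
    2:{ rewrite (indic_false _ Hi), Rmult_0_l. apply indic_bounds. }
    destruct (excluded_middle_informative (INR j * d <= 1)) as [Hj|Hj].
    2:{ rewrite (indic_false _ Hj), Rmult_0_r. apply indic_bounds. }
    rewrite (indic_true _ Hi), (indic_true _ Hj), indic_true; [lra|].
    assert (Hj0 : 0 <= INR j * d) by (apply Rmult_le_pos; [apply pos_INR|lra]).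
    (* The first point of cell [i] that is not left of [x]. *)
    exists (Rmax x (INR i * d), INR j * d). unfold K, cell; simpl.
    unfold Rmax; destruct (Rle_dec _ _); repeat split; nra. }
  assert ((y - x) * 1 <= d * s1 * (d * s2)) by (apply Rmult_le_compat; lra).
  assert (d * d * (s1 * s2) <= d * d * sumR N (fun i => sumR N (fun j => indic (meets d K i j))))
    by (apply Rmult_le_compat_l; [nra|exact Hs]).
  nra.
Qed.

Lemma interval_meas1 (S : set1) (x y m : R) :
  0 <= x <= y -> (forall t, x <= t <= y -> S t) -> meas1 S m -> y - x <= m.
Proof. intros Hxy HS [Hm _]. exact (interval_outer1 S x y m Hxy HS Hm). Qed.

(** Diagonal squares of side [s], the first with lower corner [(s, s)]: lines at distance at most
    [s] from an axis are left to the boundary functions. *)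
Definition blocks (k : nat) (s : R) : set2 := fun p => exists n, (n < k)%nat /\
  INR (S n) * s <= fst p <= INR (S (S n)) * s /\ INR (S n) * s <= snd p <= INR (S (S n)) * s.

Lemma blocks_closed (k : nat) (s : R) : closed2 (blocks k s).
Proof.
  induction k as [|k IH].
  - intros p _; exists 1; split; [lra|]. intros q _ _ (n & Hn & _); lia.
  - intros p Hp.
    destruct (IH p) as (e1 & He1 & H1).
    { intros (n & Hn & H). apply Hp; exists n; split; [lia|exact H]. }
    destruct (closed2_box (INR (S k) * s) (INR (S (S k)) * s)
                (INR (S k) * s) (INR (S (S k)) * s) p) as (e2 & He2 & H2).
    { intros H. apply Hp; exists k; split; [lia|exact H]. }
    assert (B1 := Rmin_l e1 e2). assert (B2 := Rmin_r e1 e2).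
    exists (Rmin e1 e2); split; [apply Rmin_glb_lt; assumption|].
    intros q Hq1 Hq2 (n & Hn & H). destruct (Nat.eq_dec n k) as [->|Hne].
    + apply (H2 q); try lra.
    + apply (H1 q); try lra. exists n; split; [lia|exact H].
Qed.

Lemma blocks_bounds (k : nat) (s : R) (p : pt) : 0 < s -> blocks k s p ->
  0 <= fst p <= INR (S k) * s /\ 0 <= snd p <= INR (S k) * s.
Proof.
  intros Hs (n & Hn & H1 & H2).
  assert (INR (S (S n)) * s <= INR (S k) * s)
    by (apply Rmult_le_compat_r; [lra|apply le_INR; lia]).
  assert (0 <= INR (S n) * s) by (apply Rmult_le_pos; [apply pos_INR|lra]). lra.
Qed.

Lemma blocks_outer2 (k : nat) (s : R) : 0 < s -> outer2_le (blocks k s) (INR k * (s * s)).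
Proof.
  intros Hs eps Heps.
  set (l := fun n => INR (S n) * s). set (r := fun n => l n + s * indic (n < k)%nat).
  assert (Hb := fun n => indic_bounds (n < k)%nat).
  exists l, r, l, r. split; [|split].
  - intros n; unfold r. assert (0 <= s * indic (n < k)%nat) by (apply Rmult_le_pos; [lra|apply Hb]). lra.
  - intros p (n & Hn & H1 & H2). exists n. unfold r, l. rewrite indic_true by assumption.
    rewrite (S_INR (S n)) in H1, H2. split; lra.
  - intros N. rewrite sum_f_R0_sumR.
    apply Rle_trans with (sumR k (fun n => (r n - l n) * (r n - l n))).
    + apply sumR_widen; [intros n; apply Rle_0_sqr|]. intros n Hn. unfold r. rewrite indic_false by lia. ring.
    + rewrite (sumR_ext k _ (fun _ => s * s)); [rewrite sumR_const; lra|].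
      intros n Hn. unfold r. rewrite indic_true by assumption. ring.
Qed.

(** Height and width are both [s], so the integral scales like a block of side [s]; the jump comes
    after [s], as left continuity demands. *)
Definition step (s : R) : R -> R := fun x => if Rle_dec x s then s else 0.

Lemma step_admissible (s : R) : 0 < s -> admissible_fun (step s).
Proof.
  intros Hs. unfold step. split; [|split; [|split]].
  - intros x _; destruct (Rle_dec x s); lra.
  - intros x y _ Hxy; destruct (Rle_dec x s); destruct (Rle_dec y s); lra.
  - intros x _ e He. destruct (Rle_dec x s) as [H|H].
    + exists 1; split; [lra|]. intros y _ Hy. destruct (Rle_dec y s); [|lra].
      rewrite Rminus_diag, Rabs_R0; exact He.
    + exists (x - s); split; [lra|]. intros y Hy _. destruct (Rle_dec y s); [lra|].
      rewrite Rminus_diag, Rabs_R0; exact He.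
  - exists (s + 1). intros x Hx; destruct (Rle_dec x s); lra.
Qed.

Lemma step_outer2 (s : R) : 0 < s -> outer2_le (subgraph (step s)) (s * s).
Proof.
  intros Hs eps Heps.
  exists (fun _ => 0), (fun n => s * indic (n = O)), (fun _ => 0), (fun n => s * indic (n = O)).
  assert (Hb := fun n => indic_bounds (n = O)).
  split; [|split].
  - intros n. assert (0 <= s * indic (n = O)) by (apply Rmult_le_pos; [lra|apply Hb]). lra.
  - intros p (H1 & H2). exists O. rewrite indic_true by reflexivity.
    unfold step in H2; destruct (Rle_dec _ _); lra.
  - intros N. rewrite sum_f_R0_sumR.
    eapply Rle_trans; [apply (sumR_widen _ 1)|].
    + intros n; specialize (Hb n); nra.
    + intros n Hn; rewrite indic_false by lia; ring.
    + simpl. rewrite indic_true by reflexivity. lra.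
Qed.

(** A pair leaves the L-shape by exceeding [a] in one coordinate or 1 in both; [1 < a] lets a
    coordinate above [a] escape both arms. *)
Lemma Top_of_bounds (a : R) (f g : R -> R) (A : set2) (x : pt) :
  quadrant x ->
  (forall m1 m2, meas1 (rowset x A) m1 -> meas1 (colset x A) m2 ->
     1 < a /\ (a < m1 + f (snd x) \/ a < m2 + g (fst x) \/
               (1 < m1 + f (snd x) /\ 1 < m2 + g (fst x)))) ->
  Top (Lshape a) f g A x.
Proof.
  intros Hq H. right; split; [exact Hq|]. intros (m1 & m2 & H1 & H2 & HZ).
  specialize (H m1 m2 H1 H2). destruct HZ as [[Z1 Z2]|[Z1 Z2]]; simpl in *; lra.
Qed.

Lemma line_covered (k : nat) (s v : R) : 0 < s -> 0 <= v <= INR (S k) * s ->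
  v <= s \/ exists n, (n < k)%nat /\ INR (S n) * s <= v <= INR (S (S n)) * s.
Proof.
  intros Hs; induction k as [|k IH]; intros Hv.
  - simpl in Hv; left; lra.
  - destruct (Rle_lt_dec v (INR (S k) * s)) as [H|H].
    + destruct IH as [IH|(n & Hn & IH)]; [lra|left; exact IH|].
      right; exists n; split; [lia|exact IH].
    + right; exists k; split; [lia|lra].
Qed.

(** Three rounds suffice. The square [[0, L]^2] fills because each of its lines gets [s > 1] from a
    block or from [step]; then the strips of width [s] along the axes fill; then every line crosses
    a strip in length [s > 1]. *)
Lemma blocks_span (k : nat) (s : R) : (1 <= k)%nat -> 1 < s ->
  Espans (Lshape (INR (k + 2))) (step s) (step s) (blocks k s).
Proof.
  intros Hk Hs x Hx. exists 3%nat.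
  set (a := INR (k + 2)). set (L := INR (S k) * s).
  assert (Hk1 : 1 <= INR k) by (apply (le_INR 1 k); exact Hk).
  assert (Ha : a = INR k + 2) by (unfold a; rewrite plus_INR; simpl; lra).
  (* [L + s = (k + 2) s], which exceeds [a = k + 2]; this fills the strips in the second round. *)
  assert (HL : L + s > a) by (unfold L; rewrite S_INR; nra).
  assert (HsL : 2 * s <= L) by (unfold L; rewrite S_INR; nra).
  set (T := Top (Lshape a) (step s) (step s)).
  assert (Hstep0 : forall v, 0 <= step s v) by (intros v; unfold step; destruct (Rle_dec _ _); lra).
  assert (Hstep1 : forall v, v <= s -> step s v = s)
    by (intros v Hv; unfold step; destruct (Rle_dec _ _); lra).
  assert (T1 : forall p, 0 <= fst p <= L -> 0 <= snd p <= L -> T (blocks k s) p).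
  { intros p H1 H2. apply Top_of_bounds; [split; lra|]. intros m1 m2 Hm1 Hm2.
    assert (P1 : 0 <= m1) by (apply outer1_nonneg with (rowset p (blocks k s)); apply Hm1).
    assert (P2 : 0 <= m2) by (apply outer1_nonneg with (colset p (blocks k s)); apply Hm2).
    assert (E1 : s <= m1 + step s (snd p)).
    { destruct (line_covered k s (snd p)) as [Hc|(n & Hn & Hc)]; try lra; [exact H2| |].
      - rewrite Hstep1; lra.
      - assert (INR (S (S n)) * s - INR (S n) * s <= m1).
        { apply (interval_meas1 _ (INR (S n) * s) (INR (S (S n)) * s) m1) in Hm1; auto.
          - split; [apply Rmult_le_pos; [apply pos_INR|lra]|lra].
          - intros t Ht. exists n; auto. }
        rewrite (S_INR (S n)) in H. specialize (Hstep0 (snd p)). lra. }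
    assert (E2 : s <= m2 + step s (fst p)).
    { destruct (line_covered k s (fst p)) as [Hc|(n & Hn & Hc)]; try lra; [exact H1| |].
      - rewrite Hstep1; lra.
      - assert (INR (S (S n)) * s - INR (S n) * s <= m2).
        { apply (interval_meas1 _ (INR (S n) * s) (INR (S (S n)) * s) m2) in Hm2; auto.
          - split; [apply Rmult_le_pos; [apply pos_INR|lra]|lra].
          - intros t Ht. exists n; auto. }
        rewrite (S_INR (S n)) in H. specialize (Hstep0 (fst p)). lra. }
    lra. }
  assert (T2 : forall p, quadrant p -> fst p <= s \/ snd p <= s -> T (T (blocks k s)) p).
  { intros p [Q1 Q2] Hp. apply Top_of_bounds; [split; assumption|]. intros m1 m2 Hm1 Hm2.
    split; [lra|]. destruct Hp as [Hp|Hp].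
    - right; left. rewrite Hstep1 by exact Hp.
      apply (interval_meas1 _ 0 L m2) in Hm2; [lra|lra|]. intros t Ht; apply T1; simpl; lra.
    - left. rewrite Hstep1 by exact Hp.
      apply (interval_meas1 _ 0 L m1) in Hm1; [lra|lra|]. intros t Ht; apply T1; simpl; lra. }
  destruct Hx as [Q1 Q2].
  change (T (T (T (blocks k s))) x). apply Top_of_bounds; [split; assumption|].
  intros m1 m2 Hm1 Hm2.
  apply (interval_meas1 _ 0 s m1) in Hm1; [|lra|intros t Ht; apply T2; [split|]; simpl; lra].
  apply (interval_meas1 _ 0 s m2) in Hm2; [|lra|intros t Ht; apply T2; [split|]; simpl; lra].
  assert (F1 := Hstep0 (fst x)). assert (F2 := Hstep0 (snd x)). lra.
Qed.

Lemma block_objective (k : nat) (alpha s : R) : (1 <= k)%nat -> alpha <= 1 -> 1 < s ->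
  exists v, objective_value alpha alpha (Lshape (INR (k + 2))) v /\
            v <= (INR (k + 2) - 2 * alpha) * (s * s).
Proof.
  intros Hk Hal Hs.
  destruct (area_exists (blocks k s) (INR k * (s * s))) as (mA & HA & HAle).
  { apply blocks_outer2; lra. }
  destruct (area_exists (subgraph (step s)) (s * s)) as (mf & Hf & Hfle).
  { apply step_outer2; lra. }
  exists (mA + (1 - alpha) * mf + (1 - alpha) * mf). split.
  - exists (blocks k s), (step s), (step s), mA, mf, mf.
    split; [|split; [split|]].
    + intros x Hx. apply blocks_bounds in Hx; [|lra]. split; lra.
    + apply blocks_closed.
    + exists (INR (S k) * s). intros p Hp. apply blocks_bounds in Hp; [|lra].
      rewrite !Rabs_pos_eq; lra.
    + repeat split; try (apply step_admissible; lra); try apply HA; try apply Hf.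
      apply blocks_span; assumption.
  - rewrite plus_INR; simpl.
    assert ((1 - alpha) * mf <= (1 - alpha) * (s * s)) by (apply Rmult_le_compat_l; lra).
    lra.
Qed.

(** * Assembling the two bounds *)

Lemma error_term_ge (alpha : R) : / 2 <= alpha < 1 -> 1 <= 9 * Rpower alpha (3 / 2).
Proof.
  intros Hal.
  (* For [alpha < 1] raising the exponent to 2 lowers the power, and [9 * alpha^2 >= 9 / 4]. *)
  assert (H : Rpower alpha (INR 2) <= Rpower alpha (3 / 2)).
  { unfold Rpower. apply Rlt_le, exp_increasing.
    assert (ln alpha < 0) by (rewrite <- ln_1; apply ln_increasing; lra).
    simpl; nra. }
  rewrite Rpower_pow in H by lra. simpl in H. nra.
Qed.

Theorem mainTheorem16 (a : nat) (Ha : (3 <= a)%nat) (alpha : R)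
  (Hal : 0 < alpha < 1) :
  exists I : R,
    Itilde_is alpha alpha
      (fun p => Rect (INR a) 1 p \/ Rect 1 (INR a) p) I /\
    INR a - 2 * alpha - 9 * INR a * Rpower alpha (3 / 2) <= I /\
    I <= INR a - 2 * alpha.
Proof.
  change (fun p => Rect (INR a) 1 p \/ Rect 1 (INR a) p) with (Lshape (INR a)).
  (* [k = a - 2] is the number of diagonal blocks. *)
  destruct (Nat.le_exists_sub 2 a ltac:(lia)) as [k [-> _]].
  assert (Hk : (1 <= k)%nat) by lia.
  assert (Ha3 : 3 <= INR (k + 2)) by (replace 3 with (INR 3) by (simpl; lra); apply le_INR; lia).
  destruct (glb_exists (objective_value alpha alpha (Lshape (INR (k + 2)))) 0) as (I & HI1 & HI2).
  { destruct (block_objective k alpha 2) as [v [Hv _]]; try lia; try lra. exists v; exact Hv. }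
  { intros v Hv; apply objective_nonneg in Hv; lra. }
  exists I. split; [split; assumption|split].
  - assert (HR : 0 < Rpower alpha (3 / 2)) by apply exp_pos.
    destruct (Rle_lt_dec alpha (/ 2)) as [Hle|Hgt].
    + apply Rnot_lt_le; intros Hlt.
      destruct (HI2 (INR (k + 2) - 2 * alpha - I)) as (v & Hv & Hvlt); [nra|].
      apply objective_lower_bound in Hv; lra.
    (* The error term is now at least [a], so the claimed bound is negative while all objective
       values are nonnegative. *)
    + assert (E := error_term_ge alpha ltac:(lra)).
      apply Rle_trans with 0; [nra|].
      apply Rnot_lt_le; intros Hlt.
      destruct (HI2 (- I)) as (v & Hv & Hvlt); [lra|].
      apply objective_nonneg in Hv; lra.
  - set (c := INR (k + 2) - 2 * alpha) in *.
    assert (Hc : 0 < c) by (unfold c; lra).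
    apply Rnot_lt_le; intros Hlt.
    (* For [t <= 1] one has [(1 + t)^2 <= 1 + 3 t], so blocks of side [1 + t] cost at most
       [c + 3 c t <= c + 3 (I - c) / 4 < I]. *)
    set (t := Rmin 1 ((I - c) / (4 * c))).
    assert (Ht : 0 < t) by (apply Rmin_glb_lt; [lra|apply Rdiv_lt_0_compat; lra]).
    assert (Ht1 : t <= 1) by apply Rmin_l.
    assert (Ht2 : t * (4 * c) <= I - c).
    { replace (I - c) with ((I - c) / (4 * c) * (4 * c)) by (field; lra).
      apply Rmult_le_compat_r; [lra|apply Rmin_r]. }
    destruct (block_objective k alpha (1 + t)) as (v & Hv & Hvle); try lia; try lra.
    fold c in Hvle. apply HI1 in Hv. clearbody t c.
    assert (c * (t * t) <= c * t) by (apply Rmult_le_compat_l; nra).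
    nra.
Qed.
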